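(* Let $X$ be a uniformly perfect metric space with more than one point, let $\Phi$ be an admissible function, and let $F\subseteq X$ be non-empty and totally bounded with $\dim_{\mathrm A}F<\infty$. (i) If $\overline{\dim}^\Phi F>0$ then for all $s\in(0,\overline{\dim}^\Phi F)$ there exists a constant $c\in(0,\infty)$ such that for all $\delta_0>0$ there exist $\delta'\in(0,\delta_0)$ and a Borel probability measure $\mu_{\delta'}$ with finite support $\mathrm{supp}(\mu_{\delta'})\subseteq F$ such that if $x\in X$ and $\Phi(\delta')\le r\le\delta'$ then $$\mu_{\delta'}(B(x,r))\le c\,r^s.$$ (ii) If $\underline{\dim}^\Phi F>0$ then for all $s\in(0,\underline{\dim}^\Phi F)$ there exists $c\in(0,\infty)$ such that for all sufficiently small $\delta'>0$ there exists a Borel probability measure $\mu_{\delta'}$ with finite support $\mathrm{supp}(\mu_{\delta'})\subseteq F$ such that if $x\in X$ and $\Phi(\delta')\le r\le\delta'$ then $\mu_{\delta'}(B(x,r))\le c\,r^s$.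
   Context: For a subset $U$ of a metric space, $|U|$ denotes its diameter, and $B(x,r)$ is the open ball in $X$. Convention: $\inf\varnothing=\infty$. A metric space $X$ is uniformly perfect if there is $c'\in(0,1)$ such that $B(x,R)\setminus B(x,c'R)\neq\varnothing$ for all $x\in X$ and $0<R<|X|$. $N_\delta(F)$ is the smallest number of open balls of radius $\delta/2$ with centres in $F$ needed to cover $F$; $F$ is totally bounded if $N_\delta(F)<\infty$ for all $\delta>0$. A function $\Phi\colon(0,\Delta)\to\mathbb{R}$ (for some $\Delta>0$) is admissible if it is monotonic, $0<\Phi(\delta)\le\delta$ for all $\delta\in(0,\Delta)$, and $\Phi(\delta)/\delta\to0$ as $\delta\to0^+$. For a non-empty totally bounded $F\subseteq X$ and admissible $\Phi$, the upper $\Phi$-intermediate dimension $\overline{\dim}^\Phi F$ is the infimum of all $s\ge0$ such that for all $\epsilon>0$ there exists $\delta_0\in(0,1]$ (with $(0,\delta_0)$ contained in the domain of $\Phi$) such that for all $\delta\in(0,\delta_0)$ there is a finite or countable cover $\{U_1,U_2,\dots\}$ of $F$ by subsets of $X$ with $\Phi(\delta)\le|U_i|\le\delta$ for all $i$ and $\sum_i|U_i|^s\le\epsilon$. The lower $\Phi$-intermediate dimension $\underline{\dim}^\Phi F$ is the infimum of all $s\ge0$ such that for all $\epsilon>0$ and $\delta_0\in(0,1]$ there exist $\delta\in(0,\delta_0)$ (in the domain of $\Phi$) and such a cover of $F$ with $\Phi(\delta)\le|U_i|\le\delta$ for all $i$ and $\sum_i|U_i|^s\le\epsilon$. The Assouad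 dimension $\dim_{\mathrm A}F$ is the infimum of all $a$ for which there exists $C>0$ such that $N_r(B(x,R)\cap F)\le C(R/r)^a$ for all $x\in F$ and $0<r<R$. *)

(* Defs.v *)
From HB Require Import structures.
From mathcomp Require Import all_boot all_order all_algebra finmap.
From mathcomp Require Import all_classical all_reals all_analysis.

Set Implicit Arguments.
Unset Strict Implicit.
Unset Printing Implicit Defensive.

Import Order.TTheory GRing.Theory Num.Theory.
Import numFieldNormedType.Exports.

Local Open Scope classical_set_scope.
Local Open Scope ring_scope.

(* Measurable types are pointed in MathComp-Analysis, so Borel measures on a
   metric space need a (non-canonical) distinguished point; no axiom relates it
   to the metric. *)
#[short(type="pMetricType")]
HB.structure Definition PointedMetric (R : numDomainType) :=
  {X of Metric R X & Pointed X}.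

Section metric_notions.
Context {R : realType} {X : metricType R}.
Implicit Types (F U : set X).

(* Adjoining 0 only matters for the empty set, whose diameter is 0 and not the
   supremum -oo of the empty set. *)
Definition diam U : \bar R :=
  ereal_sup (0%E |` [set (mdist p.1 p.2)%:E | p in U `*` U]).

Definition covering_number (delta : R) F : \bar R :=
  ereal_inf [set (#|` A|%:R)%:E | A in
    [set A : {fset X} | [set` A] `<=` F /\
       F `<=` \bigcup_(x in [set` A]) ball x (delta / 2)]].

Definition totally_bounded F :=
  forall delta : R, 0 < delta -> (covering_number delta F < +oo)%E.

Definition assouad_dim F : \bar R :=
  ereal_inf [set a%:E | a in
    [set a : R | exists2 C : R, 0 < C &
       forall x (rho r : R), F x -> 0 < r -> r < rho ->
         (covering_number r (ball x rho `&` F) <= (C * (rho / r) `^ a)%:E)%E]].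

End metric_notions.

Definition uniformly_perfect {R : realType} (X : metricType R) :=
  exists c : R, [/\ 0 < c, c < 1 &
    forall (x : X) (rho : R), 0 < rho -> (rho%:E < diam [set: X])%E ->
      ball x rho `\` ball x (c * rho) !=set0].

(* A function on (0, Delta) is represented by a total function on R of which
   only the values on (0, Delta) are ever used. *)
Definition admissible {R : realType} (Delta : R) (Phi : R -> R) :=
  [/\ 0 < Delta,
      {in `]0, Delta[ &, {homo Phi : x y / x <= y}} \/
      {in `]0, Delta[ &, {homo Phi : x y /~ x <= y}},
      {in `]0, Delta[, forall delta, 0 < Phi delta <= delta} &
      Phi delta / delta @[delta --> 0^'+] --> 0].

Section intermediate_dimensions.
Context {R : realType} {X : metricType R}.
Variables (Delta : R) (Phi : R -> R) (F : set X).

(* The index set I may be finite or infinite: covers are at most countable. *)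
Definition has_Phi_cover (s eps delta : R) :=
  exists (I : set nat) (U : nat -> set X),
    [/\ F `<=` \bigcup_(i in I) U i,
        forall i, I i ->
          ((Phi delta)%:E <= diam (U i))%E /\ (diam (U i) <= delta%:E)%E &
        (\esum_(i in I) (diam (U i) `^ s) <= eps%:E)%E].

Definition upper_Phi_dim : \bar R :=
  ereal_inf [set s%:E | s in
    [set s : R | 0 <= s /\ forall eps : R, 0 < eps ->
       exists delta0 : R, [/\ 0 < delta0, delta0 <= 1, delta0 <= Delta &
         forall delta : R, 0 < delta -> delta < delta0 ->
           has_Phi_cover s eps delta]]].

Definition lower_Phi_dim : \bar R :=
  ereal_inf [set s%:E | s in
    [set s : R | 0 <= s /\ forall eps delta0 : R,
       0 < eps -> 0 < delta0 -> delta0 <= 1 ->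
       exists delta : R, [/\ 0 < delta, delta < delta0, delta < Delta &
         has_Phi_cover s eps delta]]].

End intermediate_dimensions.

Notation borel X := (g_sigma_algebraType (@open X)).

(* The support is the smallest closed set of full measure. Such a set need not
   exist for an arbitrary Borel measure on a non-separable space, hence a
   relation instead of a function. *)
Definition is_support {R : realType} (X : pMetricType R)
    (mu : probability (borel X) R) (S : set X) :=
  [/\ closed S, mu (~` S) = 0%E &
      forall C : set X, closed C -> mu (~` C) = 0%E -> S `<=` C].

(* Main.v *)
Require Import Defs.
From HB Require Import structures.
From mathcomp Require Import all_boot all_order all_algebra finmap.
From mathcomp Require Import all_classical all_reals all_analysis.
From mathcomp Require Import lra ring.

(** Fix [delta] admitting no [Phi]-cover of small cost, and let [S] be a finite
    [Phi delta]-net of [F].  Put weights on [S] greedily, as large as possible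
    subject to [w (B(x, rho)) <= rho ^ s] for [x] in [S] and finitely many radii
    [rho] between [Phi delta] and a fixed multiple of [delta].  Every point of
    [S] then lies in a saturated ball; by Vitali's argument disjoint saturated
    balls can be chosen whose enlargements cover [F], with diameters in
    [[Phi delta, delta]] by uniform perfectness.  The cost of this cover is at
    most a constant times the total weight, which is therefore bounded below,
    and normalising [w] gives the measure.  Finiteness of the Assouad dimension
    transfers the bound to arbitrary centres and to radii up to [delta]. *)

Set Implicit Arguments.
Unset Strict Implicit.
Unset Printing Implicit Defensive.

Import Order.TTheory GRing.Theory Num.Theory.
Import numFieldNormedType.Exports.

Local Open Scope classical_set_scope.
Local Open Scope ring_scope.

(** * Greedy weights and disjoint balls on a finite set *)

(* Points are treated one at a time, each receiving the largest weight that the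
   constraints still allow; a saturated constraint stays saturated. *)
Lemma saturated_weights (R : realDomainType) (T : eqType) (J : finType)
    (B : J -> pred T) (b : J -> R) (S : seq T) :
  uniq S -> (forall j, 0 <= b j) ->
  {in S, forall x, exists j, B j x} ->
  exists w : T -> R,
    [/\ forall x, 0 <= w x,
        forall j, \sum_(x <- S | B j x) w x <= b j &
        {in S, forall y, exists2 j, B j y & \sum_(x <- S | B j x) w x = b j}].
Proof.
move=> + b0; elim: S => [_ _|y S IH /= /andP[yS uS] cov].
  by exists (fun=> 0); split => // j; rewrite big_nil.
have [|w [w0 wb wt]] := IH uS.
  by move=> x xS; apply: cov; rewrite inE xS orbT.
have [j0 j0y] : exists j, B j y by apply: cov; rewrite mem_head.
pose slack j := b j - \sum_(x <- S | B j x) w x.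
(* The new point receives the least slack among the constraints through it. None of them is then
   violated, and [j1] becomes saturated. *)
pose j1 := [arg min_(j < j0 | B j y) slack j]%O.
have [j1y j1min] : B j1 y /\ forall j, B j y -> slack j1 <= slack j.
  by rewrite /j1; case: arg_minP.
pose w' x := if x == y then slack j1 else w x.
have w'E j : \sum_(x <- y :: S | B j x) w' x =
    (if B j y then slack j1 else 0) + \sum_(x <- S | B j x) w x.
  rewrite big_cons {1}/w' eqxx.
  have -> : \sum_(x <- S | B j x) w' x = \sum_(x <- S | B j x) w x.
    rewrite big_seq_cond [RHS]big_seq_cond; apply: eq_bigr => x /andP[xS _].
    by rewrite /w'; case: eqP xS yS => // -> ->.
  by case: ifP => // _; rewrite add0r.
have w'b j : \sum_(x <- y :: S | B j x) w' x <= b j.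
  rewrite w'E; case: ifP => jy; last by rewrite add0r.
  by rewrite -lerBrDr; exact: j1min.
have slack0 : 0 <= slack j1 by rewrite subr_ge0.
exists w'; split => // [x|x].
  by rewrite /w'; case: ifP.
rewrite inE => /orP[/eqP ->|/wt [j jx jb]].
  by exists j1 => //; rewrite w'E j1y subrK.
exists j => //; apply/le_anti; rewrite w'b /= w'E -jb lerDr.
by case: ifP.
Qed.

(** Vitali selection: keep a member of [G] of largest radius, discard everything that meets it, and
    recurse on the strictly smaller remainder. Whatever is discarded has radius at most that of the
    member it meets. *)
Lemma disjoint_subfamily (R : realDomainType) (J : finType) (rho : J -> R)
    (meets : rel J) (G : {set J}) :
  reflexive meets -> symmetric meets ->
  exists D : {set J},
    [/\ D \subset G, {in D &, forall i j, meets i j -> i = j} &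
        {in G, forall j, exists2 i, i \in D & meets i j && (rho j <= rho i)}].
Proof.
move=> mr ms; have [n] := ubnP #|G|; elim: n G => // n IH G.
have [->|[j0 j0G]] := set_0Vmem G.
  by exists finset.set0; split => // j; rewrite inE.
have [j1 j1G j1max] : exists2 j1, j1 \in G & {in G, forall j, rho j <= rho j1}.
  case: (@arg_maxP _ _ _ j0 (mem G) rho j0G) => j1 j1G h.
  by exists j1.
move=> Gn; pose G' := [set j in G | ~~ meets j1 j]%SET.
have [|D [DG' Dd Dc]] := IH G'.
  rewrite (leq_trans _ (_ : #|G| <= n)%N)//; apply: proper_card.
  apply/properP; split.
    by apply/fintype.subsetP => j; rewrite inE => /andP[].
  by exists j1 => //; rewrite inE mr andbF.
have DG j : j \in D -> j \in G /\ ~~ meets j1 j.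
  by move=> /(fintype.subsetP DG'); rewrite inE => /andP[].
exists (j1 |: D)%SET; split => [|i j|j jG].
- by apply/fintype.subsetP => j; rewrite !inE => /orP[/eqP ->//|/DG[]].
- rewrite !inE => /orP[/eqP ->|iD] /orP[/eqP ->|jD] // m; last exact: Dd.
    by have [_ /negP] := DG _ jD.
  by have [_ /negP] := DG _ iD; rewrite ms.
- have [m|m] := boolP (meets j1 j).
    by exists j1; rewrite ?setU11// m j1max.
  have [|i iD h] := Dc j; first by rewrite inE jG.
  by exists i; rewrite // inE iD orbT.
Qed.

Lemma sum_disjoint_le (R : realDomainType) (T : eqType) (J : finType)
    (B : J -> pred T) (w : T -> R) (S : seq T) (D : {set J}) :
  (forall x, 0 <= w x) ->
  {in S, forall x, {in D &, forall i j, B i x -> B j x -> i = j}} ->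
  \sum_(j in D) \sum_(x <- S | B j x) w x <= \sum_(x <- S) w x.
Proof.
move=> w0 disj; rewrite (exchange_big_dep predT)//= big_seq [leRHS]big_seq.
apply: ler_sum => x xS; rewrite sumr_const -mulr_natr ler_piMr// lern1.
by apply/card_le1_eqP => i j /andP[iD ix] /andP[jD jx]; apply: (disj x).
Qed.

Lemma sum_cover_le (R : realDomainType) (T A : eqType) (P : pred T)
    (Q : A -> pred T) (w : T -> R) (S : seq T) (l : seq A) :
  (forall x, 0 <= w x) ->
  {in S, forall x, P x -> has (Q ^~ x) l} ->
  \sum_(x <- S | P x) w x <= \sum_(a <- l) \sum_(x <- S | Q a x) w x.
Proof.
move=> w0 cov; rewrite (exchange_big_dep predT)//= big_mkcond/=.
rewrite big_seq [leRHS]big_seq; apply: ler_sum => x xS.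
case: ifP => [/(cov x xS)/hasP[a al aQ]|_]; last exact: sumr_ge0.
by rewrite (big_rem a)//= aQ lerDl sumr_ge0.
Qed.

(** The list [D] is a Vitali subfamily of the saturated balls. Saturation turns each [g p.2] into
    the weight of a ball, and disjointness bounds the sum of these weights by the total. The factor
    3 is the Vitali enlargement of a ball that swallows any ball of no larger radius meeting it. *)
Lemma frostman_weights (R : realType) (X : metricType R) (S : seq X)
    (radii : seq R) (g : R -> R) :
  uniq S -> radii != [::] -> {in radii, forall rho, 0 < rho} ->
  (forall rho, 0 <= g rho) ->
  exists (w : X -> R) (D : seq (X * R)),
    [/\ forall x, 0 <= w x,
        {in S & radii, forall x rho,
          \sum_(y <- S | mdist x y < rho) w y <= g rho},
        {in D, forall p, p.2 \in radii},
        {in S, forall y, exists2 p, p \in D & mdist p.1 y < 3 * p.2} &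
        \sum_(p <- D) g p.2 <= \sum_(y <- S) w y].
Proof.
move=> uS radii0 radiigt0 g0.
pose J := (seq_sub S * seq_sub radii)%type.
pose ctr (j : J) := ssval j.1; pose rho (j : J) := ssval j.2.
pose B (j : J) := [pred y | mdist (ctr j) y < rho j].
have ctrS j : ctr j \in S by exact: ssvalP.
have rhoR j : rho j \in radii by exact: ssvalP.
have rho0 j : 0 < rho j by exact: radiigt0.
have [||w [w0 wb wt]] := @saturated_weights R X J B (g \o rho) S uS.
- by move=> j; exact: g0.
- case: radii radii0 radiigt0 @J @ctr @rho @B ctrS rhoR rho0 => // r l _ rgt0.
  move=> J ctr rho B _ _ _ x xS.
  exists (SeqSub xS, SeqSub (mem_head r l)).
  by rewrite /B/= /ctr/= mdistxx rgt0// mem_head.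
(* Balls count as meeting only if they share a point of [S]: the sums run over [S], so this is the
   disjointness that the counting requires. *)
pose meets i j := has (fun x => B i x && B j x) S.
pose G := [set j | \sum_(x <- S | B j x) w x == g (rho j)]%SET.
have [||D [DG Dd Dc]] := @disjoint_subfamily R J rho meets G.
- move=> j; apply/hasP; exists (ctr j); first exact: ctrS.
  by rewrite /= mdistxx rho0.
- move=> i j; apply/hasP/hasP => -[x xS /andP[? ?]];
    by exists x => //=; apply/andP.
exists w, [seq (ctr j, rho j) | j <- enum D]; split => //.
- move=> x r xS rr; exact: (wb (SeqSub xS, SeqSub rr)).
- move=> p /mapP[j _ ->]; exact: rhoR.
- move=> y yS; have [j jy jt] := wt _ yS.
  have [|i iD /andP[/hasP[z _ /andP[/= iz jz]] ji]] := Dc j.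
    by rewrite inE; apply/eqP.
  exists (ctr i, rho i) => /=; first by apply: map_f; rewrite mem_enum.
  rewrite (le_lt_trans (metric_triangle _ z _))//.
  have := metric_triangle z (ctr j) y; rewrite (metric_sym z (ctr j)).
  move: jy iz jz ji => /=; rewrite !mulrDl !mul1r.
  lra.
- rewrite big_map big_enum/=.
  rewrite (eq_bigr (fun j => \sum_(x <- S | B j x) w x)).
    apply: sum_disjoint_le => // x xS i j iD jD ix jx.
    by apply: Dd => //; apply/hasP; exists x => //=; apply/andP.
  by move=> j /(fintype.subsetP DG); rewrite inE => /eqP ->.
Qed.

(** The radii are [phi * 2 ^+ k], truncated at [eta]. Below [eta], neighbouring radii differ by a
    factor of at most 2, hence at most [A]; above it, [eta] itself serves up to [A * eta]. *)
Lemma geometric_radii (R : archiRealFieldType) (phi eta A : R) :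
  0 < phi -> phi <= eta -> 2 <= A ->
  exists l : seq R,
    [/\ l != [::], {in l, forall rho, phi <= rho <= eta} &
      forall r, phi <= r -> r <= A * eta ->
        exists2 rho, rho \in l & rho <= r <= A * rho].
Proof.
move=> phi0 phieta A2.
have [n etan] : exists n, eta <= phi * 2 ^+ n.
  exists (Num.bound (eta / phi)); rewrite mulrC -ler_pdivrMr//.
  exact/ltW/upper_nthrootP.
exists [seq Num.min eta (phi * 2 ^+ k) | k <- iota 0 n.+1]; split => //.
- move=> _ /mapP[k _ ->]; rewrite le_min phieta ge_min lexx /= andbT.
  by rewrite ler_peMr ?(ltW phi0)// exprn_ege1// ler1n.
- move=> r phir rA; have [etar|reta] := leP eta r.
    exists eta; last by rewrite etar.
    apply/mapP; exists n; first by rewrite mem_iota/= add0n ltnSn.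
    by apply/esym/min_idPl.
  (* Take the first dyadic radius exceeding [r]. It is not the zeroth, because [phi <= r], so its
     predecessor exists and is the radius sought. *)
  have ex : exists k, r < phi * 2 ^+ k by exists n; exact: lt_le_trans etan.
  case: (ex_minnP ex) => [[|k]]; first by rewrite expr0 mulr1 ltNge phir.
  move=> rk kmin.
  have kr : phi * 2 ^+ k <= r.
    by rewrite leNgt; apply/negP => /kmin; rewrite ltnn.
  exists (phi * 2 ^+ k).
    apply/mapP; exists k.
      by rewrite mem_iota/= add0n ltnS ltnW// kmin// (lt_le_trans reta).
    by apply/esym/min_idPr; rewrite (le_trans kr)// ltW.
  rewrite kr/= (le_trans (ltW rk))// exprS mulrCA ler_wpM2r//.
  by rewrite mulr_ge0 ?exprn_ge0// ltW.
Qed.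

(** * Finitely supported probability measures *)

Lemma discrete_probability (R : realType) d (T : measurableType d) (S : seq T)
    (w : T -> R) :
  (forall x, 0 <= w x) -> 0 < \sum_(y <- S) w y ->
  exists mu : probability T R, forall A : set T,
    mu A = ((\sum_(y <- S | y \in A) w y) / \sum_(y <- S) w y)%:E.
Proof.
move=> w0 W0; pose m (k : nat) : {measure set T -> \bar R} :=
  mscale (NngNum (w0 (nth point S k))) (dirac (nth point S k)).
have mE A : msum m (size S) A = (\sum_(y <- S | y \in A) w y)%:E.
  rewrite [in RHS]big_mkcond/= (big_nth point)/= big_mkord -sumEFin.
  apply: eq_bigr => k _; rewrite /m/= /mscale/= diracE -EFinM.
  by case: ifP => _; rewrite ?mulr1 ?mulr0.
(* The Dirac mass is the default of [mnormalize] for total mass zero or infinity, which [W0] and the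
   finiteness of the sum exclude. *)
exists (mnormalize (msum m (size S)) (dirac point)) => A.
rewrite /= /mnormalize/= !mE.
have -> : \sum_(y <- S | y \in [set: T]) w y = \sum_(y <- S) w y.
  by apply: eq_bigl => y; rewrite in_setT.
by rewrite orbF eqe gt_eqF//= mE EFinM.
Qed.

(** A finite set is closed in a metric space, and a point of positive weight outside a closed set
    would give its complement positive mass. *)
Lemma discrete_support (R : realType) (X : pMetricType R) (S : seq X)
    (w : X -> R) (mu : probability (borel X) R) :
  (forall x, 0 <= w x) -> 0 < \sum_(y <- S) w y ->
  (forall A : set X,
    mu A = ((\sum_(y <- S | y \in A) w y) / \sum_(y <- S) w y)%:E) ->
  is_support mu [set y | y \in S /\ 0 < w y] /\
  finite_set [set y | y \in S /\ 0 < w y].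
Proof.
move=> w0 W0 muE.
have fin : finite_set [set y | y \in S /\ 0 < w y].
  by apply: (sub_finite_set _ (finite_seq S)) => y [].
split => //; split.
- by apply: (accessible_finite_set_closed.1 _ _ fin);
    exact/hausdorff_accessible/metric_hausdorff.
- rewrite muE big_seq_cond big1 ?mul0r// => y /andP[yS].
  rewrite inE /= => yN; apply/eqP; rewrite eq_le w0 andbT leNgt.
  by apply/negP => wy; apply: yN.
- move=> C _ muC y [yS wy]; apply: contrapT => yC.
  have /eqP : (\sum_(z <- S | z \in ~` C) w z) / \sum_(z <- S) w z = 0.
    by apply: EFin_inj; rewrite -muE.
  rewrite mulf_eq0 invr_eq0 (gt_eqF W0) orbF.
  rewrite psumr_eq0// => /allP/(_ y yS); rewrite gt_eqF// implybF.
  by rewrite (_ : y \in ~` C)//; exact/mem_set.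
Qed.

(** * Diameters of balls, and covers from finite lists *)

Lemma diam_ball_le (R : realType) (X : metricType R) (x : X) (r : R) :
  0 <= r -> (diam (ball x r) <= (2 * r)%:E)%E.
Proof.
move=> r0; apply: ge_ereal_sup => _ [->|[[y z]/= yz <-]].
  by rewrite lee_fin mulr_ge0.
move: yz; rewrite !ballEmdist/= => -[/= xy xz]; rewrite lee_fin.
have := metric_triangle y x z; rewrite (metric_sym y x); lra.
Qed.

Lemma diam_ball_ge (R : realType) (X : metricType R) (x : X) (c r : R) :
  0 < r -> ball x r `\` ball x (c * r) !=set0 ->
  ((c * r)%:E <= diam (ball x r))%E.
Proof.
move=> r0 [z []]; rewrite !ballEmdist/= => xz cr.
have {}cr : c * r <= mdist x z by rewrite leNgt; apply/negP.
apply: (@le_trans _ _ (mdist x z)%:E); first by rewrite lee_fin.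
apply: ereal_sup_ubound; right; exists (x, z) => //.
by split; rewrite /= ?mdistxx.
Qed.

(** The cost is estimated through upper bounds [D] on the diameters, since for balls only two-sided
    bounds are known, not the exact diameter. *)
Lemma has_Phi_cover_seq (R : realType) (X : metricType R) (Phi : R -> R)
    (F : set X) (s eps delta : R) (I : choiceType) (l : seq I)
    (U : I -> set X) (D : I -> R) :
  0 <= s ->
  (forall x, F x -> exists2 i, i \in l & U i x) ->
  {in l, forall i, (Phi delta)%:E <= diam (U i)}%E ->
  {in l, forall i, diam (U i) <= (D i)%:E}%E ->
  {in l, forall i, D i <= delta} ->
  \sum_(i <- l) D i `^ s <= eps -> has_Phi_cover Phi F s eps delta.
Proof.
move=> s0 cov PhiU UD Dd sumD.
have diam0 (V : set X) : (0 <= diam V)%E.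
  by apply: ereal_sup_ubound; left.
case: l => [|i0 l] in cov PhiU UD Dd sumD *.
  exists set0, (fun=> set0); split => //.
    by move=> x /cov[].
  by rewrite esum_set0 lee_fin; move: sumD; rewrite big_nil.
move: {l}(i0 :: l) cov PhiU UD Dd sumD => L cov PhiU UD Dd sumD.
exists `I_(size L), (fun k => U (nth i0 L k)); split.
- move=> x /cov[i iL ix]; exists (index i L); rewrite /= ?index_mem//.
  by rewrite nth_index.
- move=> k /= kL; have nL := mem_nth i0 kL; split; first exact: PhiU.
  by rewrite (le_trans (UD _ nL))// lee_fin Dd.
- rewrite esum_fset//; last by move=> i _; exact: poweR_ge0.
  rewrite -fsbig_ord -(big_mkord xpredT (fun k => diam (U (nth i0 L k)) `^ s)%E).
  rewrite -(big_nth i0 xpredT (fun i => diam (U i) `^ s)%E).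
  rewrite -lee_fin in sumD; apply: le_trans sumD; rewrite -sumEFin.
  rewrite big_seq [leRHS]big_seq; apply: lee_sum => i iL.
  rewrite -poweR_EFin gt0_ler_poweR// ?in_itv/= ?leey ?andbT//.
    by apply: (@le_trans _ _ (diam (U i))) => //; exact: UD.
  exact: UD.
Qed.

Lemma covering_numberP (R : realType) (X : metricType R) (delta : R)
    (F : set X) (M : \bar R) :
  (covering_number delta F < M)%E ->
  exists A : {fset X}, [/\ [set` A] `<=` F,
    F `<=` \bigcup_(x in [set` A]) ball x (delta / 2) &
    ((#|` A|%:R)%:E < M)%E].
Proof. by move=> /ereal_inf_lt[_ [A [AF FA] <-] AM]; exists A. Qed.

(** * The measure at a single scale *)

(** The constant in the mass bound involves only [N], [c], [s] and [eps], so it stays the same when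
    [delta] varies. *)
Lemma frostman_at_scale (R : realType) (X : pMetricType R) (Phi : R -> R)
    (F : set X) (s eps delta c N : R) :
  0 < c -> c < 1 -> 0 < s -> 0 < eps -> 0 < N ->
  F !=set0 -> totally_bounded F ->
  0 < Phi delta -> Phi delta <= c * delta / 8 ->
  (forall (x : X) (rho : R), 0 < rho -> rho <= delta / 2 ->
    ball x rho `\` ball x (c * rho) !=set0) ->
  (forall (x : X) (sigma rho : R), F x -> 0 < sigma -> sigma < rho ->
    rho <= 16 / c * sigma ->
    (covering_number sigma (ball x rho `&` F) < N%:E)%E) ->
  ~ has_Phi_cover Phi F s eps delta ->
  exists (mu : probability (borel X) R) (S : set X),
    [/\ is_support mu S, finite_set S, S `<=` F &
      forall (x : X) (r : R), Phi delta <= r -> r <= delta ->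
        (mu (ball x r) <= (N * (8 / c) `^ s / eps * r `^ s)%:E)%E].
Proof.
move=> c0 c1 s0 eps0 N0 [z Fz] Ftb phi0 phile unif doubling ncov.
have [A [AF FA _]] := covering_numberP (Ftb _ phi0).
set phi := Phi delta in phi0 phile FA ncov *.
have cVgt1 : 1 < c^-1 by rewrite invf_gt1.
(* A selected ball of radius [rho] will be enlarged to a set of diameter at most [8 / c * rho]. The
   cap [c * delta / 8] keeps this below [delta], and the ratio [8 / c] lets the radii control every
   [r] up to [delta]. *)
have [||l [l0 lb lscale]] := @geometric_radii R phi (c * delta / 8) (8 / c) phi0.
- by [].
- by lra.
have deltaE : 8 / c * (c * delta / 8) = delta by field; rewrite gt_eqF.
have lphi rho : rho \in l -> phi <= rho by move=> /lb/andP[].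
have leta rho : rho \in l -> 8 / c * rho <= delta.
  move=> /lb/andP[_ rhoeta].
  by rewrite -deltaE ler_pM2l// divr_gt0.
have lgt0 rho : rho \in l -> 0 < rho by move=> /lphi; exact: lt_le_trans.
have [w [D [w0 wb Dl Dcov Dsum]]] :=
  @frostman_weights R X A l (fun rho => rho `^ s) (fset_uniq A) l0 lgt0
    (fun rho => powR_ge0 rho s).
set W := \sum_(y <- A) w y in Dsum.
have K0 : 0 < (8 / c) `^ s by rewrite powR_gt0// divr_gt0.
(* Otherwise the balls of radius [4 * p.2 / c] form a forbidden cover. Tripled balls contain the net
   and net points are within [phi / 2] of [F], so radius [4 * p.2] already covers [F]; dividing by
   [c] makes uniform perfectness give diameter at least [4 * p.2], hence at least [phi]. *)
have epsW : eps < (8 / c) `^ s * W.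
  rewrite ltNge; apply/negP => Weps; apply: ncov.
  apply: (@has_Phi_cover_seq R X Phi F s eps delta _ D
    (fun p => ball p.1 (4 * p.2 / c)) (fun p => 8 / c * p.2)).
  - exact: ltW.
  - move=> x /FA[y /= yA]; rewrite ballEmdist/= => yx.
    have [p pD py] := Dcov y yA; exists p => //.
    have := lphi _ (Dl _ pD); have := lgt0 _ (Dl _ pD) => p0 phip.
    have : 4 * p.2 < 4 * p.2 / c by rewrite ltr_pMr// mulr_gt0.
    rewrite ballEmdist/=; have := metric_triangle p.1 y x; lra.
  - move=> p /Dl pl; have p0 := lgt0 _ pl.
    have dp : 4 * p.2 / c <= delta / 2 by have := leta _ pl; lra.
    have dp0 : 0 < 4 * p.2 / c by rewrite divr_gt0// mulr_gt0.
    apply: le_trans (diam_ball_ge dp0 (unif _ _ dp0 dp)).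
    rewrite lee_fin (_ : c * _ = 4 * p.2); last by field; rewrite gt_eqF.
    by have := lphi _ pl; rewrite -/phi; lra.
  - move=> p /Dl/lgt0 p0; have dp0 : 0 <= 4 * p.2 / c.
      by rewrite divr_ge0// ?mulr_ge0// ltW.
    have -> : 8 / c * p.2 = 2 * (4 * p.2 / c) by ring.
    exact: diam_ball_le.
  - by move=> p /Dl/leta.
  - apply: le_trans Weps; rewrite -(ler_pM2l K0) in Dsum.
    apply: le_trans Dsum; rewrite mulr_sumr big_seq [leRHS]big_seq.
    apply: ler_sum => p /Dl/lgt0 p0; rewrite powRM// ?divr_ge0// ltW//.
have W0 : 0 < W by rewrite -(pmulr_rgt0 _ K0); exact: lt_trans epsW.
have [mu muE] := @discrete_probability R _ (borel X) A w w0 W0.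
have [supp fin] := discrete_support w0 W0 muE.
exists mu, [set y | y \in enum_fset A /\ 0 < w y]; split => //.
  by move=> y [yA _]; exact: AF.
move=> x r phir rdelta; rewrite muE lee_fin -/W.
have r0 : 0 < r by exact: lt_le_trans phir.
have [rho rhol /andP[rhor rrho]] :
    exists2 rho, rho \in l & rho <= r <= 8 / c * rho.
  by apply: lscale; rewrite ?deltaE.
have rho0 := lgt0 _ rhol.
have wball : \sum_(y <- A | y \in (ball x r : set X)) w y <= N * r `^ s.
  have [[y0 y0A xy0]|none] :=
    pselect (exists2 y0, y0 \in A & ball x r y0); last first.
    rewrite big_seq_cond big1; first by rewrite mulr_ge0 ?powR_ge0// ltW.
    by move=> y /andP[yA /set_mem yx]; exfalso; apply: none; exists y.
  (* The points of [F] in [ball x r] lie within [2 * r] of [y0], and [2 * r <= 16 / c * rho].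
     Doubling thus covers them by fewer than [N] balls of radius [rho / 2]. *)
  have [||A' [A'sub A'cov A'N]] :=
      covering_numberP (doubling y0 rho (2 * r) (AF _ y0A) rho0 _ _).
  - by lra.
  - by lra.
  pose l' := enum_fset A'.
  apply: (@le_trans _ _ (\sum_(a <- l') rho `^ s)); last first.
    rewrite big_const_seq count_predT iter_addr addr0 -mulr_natl.
    rewrite ler_pM ?powR_ge0// ?ge0_ler_powR ?nnegrE// ?(ltW s0) ?(ltW rho0)//
      ?(ltW r0)//.
    by rewrite -lee_fin ltW.
  apply: (le_trans (@sum_cover_le R X X (fun y => y \in (ball x r : set X)) 
     (fun a y => mdist a y < rho / 2) w A l' w0 _)).
    move=> y yA /set_mem yx; apply/hasP.
    have [a aA' ya] : (\bigcup_(a in [set` A']) ball a (rho / 2)) y.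
      apply: A'cov; split; last exact: AF.
      move: xy0 yx; rewrite !ballEmdist/= => xy0 yx.
      have := metric_triangle y0 x y; rewrite (metric_sym y0 x); lra.
    by exists a => //; move: ya; rewrite ballEmdist.
  rewrite big_seq [leRHS]big_seq; apply: ler_sum => a _.
  (* The centre [a] lies in [F] but perhaps not in the net, where the weight bound holds. If its
     half-radius ball contains a net point [b], it is included in the ball of radius [rho] about
     [b]; otherwise it carries no weight. *)
  have [/hasP[b bA ab]|/hasPn none] := boolP (has (fun b => mdist a b < rho / 2) A).
    apply: le_trans (wb b rho bA rhol).
    rewrite big_mkcond [leRHS]big_mkcond; apply: ler_sum => y _.
    case: ifP => ay; last by case: ifP.
    rewrite ifT//; have := metric_triangle b a y; rewrite (metric_sym b a); lra.
  rewrite big_seq_cond big1 ?powR_ge0// => y /andP[yA ay].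
  by have := none y yA; rewrite ay.
rewrite ler_pdivrMr//; apply: (le_trans wball).
have Nr : 0 <= N * r `^ s by rewrite mulr_ge0 ?powR_ge0// ltW.
(* The lower bound [epsW] on the total weight pays for the normalisation by [W]. *)
have : 1 <= (8 / c) `^ s / eps * W.
  by rewrite mulrAC ler_pdivlMr// mul1r ltW.
move=> /(ler_wpM2l Nr); rewrite mulr1 => /le_trans; apply.
by rewrite le_eqVlt; apply/orP; left; apply/eqP; ring.
Qed.

(** * Uniform constants and scales without cheap covers *)

(** For ratios between 1 and [K] the Assouad bound is at most a constant. The exponent [a] may be
    negative, hence the absolute value; adding 1 makes the inequality strict. *)
Lemma assouad_dim_doubling (R : realType) (X : metricType R) (F : set X)
    (K : R) :
  1 <= K -> (assouad_dim F < +oo)%E ->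
  exists2 N : R, 0 < N &
    forall (x : X) (sigma rho : R), F x -> 0 < sigma -> sigma < rho ->
      rho <= K * sigma ->
      (covering_number sigma (ball x rho `&` F) < N%:E)%E.
Proof.
move=> K1 /ereal_inf_lt[_ [a [C C0 dimC] <-] _].
exists (C * K `^ `|a| + 1).
  by rewrite ltr_wpDl// mulr_ge0 ?powR_ge0// ltW.
move=> x sigma rho Fx sigma0 sigmarho rhoK.
apply: le_lt_trans (dimC x rho sigma Fx sigma0 sigmarho) _.
have q1 : 1 <= rho / sigma by rewrite ler_pdivlMr// mul1r ltW.
have qK : rho / sigma <= K by rewrite ler_pdivrMr.
rewrite lte_fin ltr_pwDr// ler_pM2l//.
apply: le_trans (ler_powR q1 (ler_norm a)) _.
by rewrite ge0_ler_powR// nnegrE; apply: le_trans ler01 _.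
Qed.

(** Two distinct points bound the diameter of [X] below by a positive number, so uniform perfectness
    applies at all small radii; [Phi delta / delta] tending to 0 gives the room for the enlargement
    factor [8 / c]. *)
Lemma admissible_small_scales (R : realType) (X : metricType R) (Delta : R)
    (Phi : R -> R) :
  uniformly_perfect X -> (exists x y : X, x <> y) -> admissible Delta Phi ->
  exists c : R, [/\ 0 < c, c < 1 &
    \forall delta \near 0^'+,
      [/\ delta < Delta, 0 < Phi delta, Phi delta <= c * delta / 8 &
        forall (x : X) (rho : R), 0 < rho -> rho <= delta / 2 ->
          ball x rho `\` ball x (c * rho) !=set0]].
Proof.
move=> [c [c0 c1 unif]] [x0 [y0 /eqP xy0]] [Delta0 _ Phipos Phi0].
exists c; split => //.
have d0 : 0 < mdist x0 y0 by rewrite mdist_gt0.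
have diamd : ((mdist x0 y0)%:E <= diam [set: X])%E.
  by apply: ereal_sup_ubound; right; exists (x0, y0).
have PhiC := cvgr_lt _ Phi0 (c / 8) (divr_gt0 c0 (ltr0n _ 8)).
near=> delta.
have delta0 : 0 < delta by near: delta; exact: nbhs_right_gt.
have deltaD : delta < Delta by near: delta; exact: nbhs_right_lt.
have deltad : delta < mdist x0 y0 by near: delta; exact: nbhs_right_lt.
have /andP[Phid0 _] : 0 < Phi delta <= delta.
  by apply: Phipos; rewrite in_itv/= delta0.
have PhiCd : Phi delta / delta < c / 8 by near: delta; exact: PhiC.
split => //.
  by move: PhiCd; rewrite ltr_pdivrMr// mulrAC => /ltW.
move=> x rho rho0 rhod; apply: unif => //; apply: lt_le_trans diamd.
by rewrite lte_fin; lra.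
Unshelve. all: by end_near. Qed.

(** An exponent below the infimum fails the defining condition; negating it yields one [eps] and
    arbitrarily small scales without a cover. *)
Lemma lt_upper_Phi_dim (R : realType) (X : metricType R) (Delta : R)
    (Phi : R -> R) (F : set X) (s : R) :
  0 <= s -> (s%:E < upper_Phi_dim Delta Phi F)%E ->
  exists2 eps : R, 0 < eps & forall delta0 : R,
    0 < delta0 -> delta0 <= 1 -> delta0 <= Delta ->
    exists delta : R, [/\ 0 < delta, delta < delta0 &
      ~ has_Phi_cover Phi F s eps delta].
Proof.
move=> s0; apply: contraPP => noeps; apply/negP; rewrite -leNgt.
apply: ereal_inf_lbound; exists s => //; split => // eps eps0.
apply: contrapT => nodelta0; apply: noeps; exists eps => // delta0 d0 d1 dD.
apply: contrapT => nodelta; apply: nodelta0; exists delta0; split => //.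
move=> delta delta_gt0 deltad; apply: contrapT => nocover.
by apply: nodelta; exists delta.
Qed.

(** Here the negation gives failure at every small scale, which is why the second half of the
    theorem holds for all small [delta]. *)
Lemma lt_lower_Phi_dim (R : realType) (X : metricType R) (Delta : R)
    (Phi : R -> R) (F : set X) (s : R) :
  0 <= s -> (s%:E < lower_Phi_dim Delta Phi F)%E ->
  exists2 eps : R, 0 < eps & exists2 delta0 : R, 0 < delta0 &
    forall delta : R, 0 < delta -> delta < delta0 -> delta < Delta ->
      ~ has_Phi_cover Phi F s eps delta.
Proof.
move=> s0; apply: contraPP => noeps; apply/negP; rewrite -leNgt.
apply: ereal_inf_lbound; exists s => //; split => // eps delta0 eps0 d0 _.
apply: contrapT => nodelta; apply: noeps; exists eps => //; exists delta0 => //.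
move=> delta delta_gt0 deltad deltaD cover.
by apply: nodelta; exists delta.
Qed.

(** * Both halves of the theorem *)

Theorem lemma5p2 (R : realType) (X : pMetricType R)
    (Delta : R) (Phi : R -> R) (F : set X) :
  uniformly_perfect X ->
  (exists x y : X, x <> y) ->
  admissible Delta Phi ->
  F !=set0 ->
  totally_bounded F ->
  (assouad_dim F < +oo)%E ->
  ((0 < upper_Phi_dim Delta Phi F)%E ->
   forall s : R, 0 < s -> (s%:E < upper_Phi_dim Delta Phi F)%E ->
   exists2 c : R, 0 < c &
   forall delta0 : R, 0 < delta0 ->
   exists delta : R, [/\ 0 < delta, delta < delta0, delta < Delta &
   exists (mu : probability (borel X) R) (S : set X),
     [/\ is_support mu S, finite_set S, S `<=` F &
       forall (x : X) (r : R), Phi delta <= r -> r <= delta ->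
         (mu (ball x r) <= (c * r `^ s)%:E)%E]])
  /\
  ((0 < lower_Phi_dim Delta Phi F)%E ->
   forall s : R, 0 < s -> (s%:E < lower_Phi_dim Delta Phi F)%E ->
   exists2 c : R, 0 < c &
   \forall delta \near 0^'+,
   exists (mu : probability (borel X) R) (S : set X),
     [/\ is_support mu S, finite_set S, S `<=` F &
       forall (x : X) (r : R), Phi delta <= r -> r <= delta ->
         (mu (ball x r) <= (c * r `^ s)%:E)%E]).
Proof.
move=> unif pts adm F0 Ftb Fdim.
have [c [c0 c1 small]] := admissible_small_scales unif pts adm.
have [|N N0 doubling] := @assouad_dim_doubling R X F (16 / c) _ Fdim.
  by rewrite ler_pdivlMr//; lra.
have C0 s eps : 0 < eps -> 0 < N * (8 / c) `^ s / eps.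
  by move=> eps0; rewrite divr_gt0// mulr_gt0// powR_gt0// divr_gt0.
split=> _ s s0 sdim.
- have [eps eps0 nocover] := lt_upper_Phi_dim (ltW s0) sdim.
  exists (N * (8 / c) `^ s / eps); first exact: C0.
  move=> delta0 delta0_gt0; move: small => [e /= e0 small].
  have [Delta0 _ _ _] := adm.
  pose m := Num.min (Num.min delta0 e) (Num.min 1 Delta).
  have [|||delta [delta_gt0]] := nocover m.
  + by rewrite !lt_min delta0_gt0 e0 ltr01.
  + by rewrite !ge_min lexx !orbT.
  + by rewrite !ge_min lexx !orbT.
  rewrite !lt_min => /andP[/andP[deltad deltae] /andP[_ deltaD]] ncov.
  exists delta; split => //.
  have [||_ Phi0 Phile unifd] := small delta => //=.
    by rewrite sub0r normrN gtr0_norm.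
  exact: (@frostman_at_scale R X Phi F s eps delta c N).
- have [eps eps0 [delta0 delta0_gt0 nocover]] := lt_lower_Phi_dim (ltW s0) sdim.
  exists (N * (8 / c) `^ s / eps); first exact: C0.
  near=> delta.
  have delta_gt0 : 0 < delta by near: delta; exact: nbhs_right_gt.
  have deltad : delta < delta0 by near: delta; exact: nbhs_right_lt.
  have [deltaD Phi0 Phile unifd] : [/\ delta < Delta, 0 < Phi delta,
      Phi delta <= c * delta / 8 &
      forall (x : X) (rho : R), 0 < rho -> rho <= delta / 2 ->
        ball x rho `\` ball x (c * rho) !=set0] by near: delta; exact: small.
  by apply: (@frostman_at_scale R X Phi F s eps delta c N) => //; exact: nocover.
Unshelve. all: by end_near. Qed.
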